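(* Let $\{c_n\}_{n\ge 1}$ be a sequence of positive integers with $c_n \mid c_{n+1}$ for all $n$, and let $S$, $<$, $+$, $-$, $\cdot$, ${}^{-1}$, $0$, $1$ be as described in the context. Then $(S,+,\cdot,<)$ is an ordered field in which every nonempty subset bounded from above has a supremum; consequently $S$ with these operations and this order is isomorphic, as an ordered field, to the complete ordered field $\mathbb{R}$ of real numbers.
   Context: A sequence $\{a_n\}_{n\ge1}$ of positive integers lies in $U$ if $a_{n+1} \ge \frac{c_{n+1}}{c_n} a_n(a_n+1)$ for all $n \ge 1$. $S$ is the set of sequences $(q_n)_{n\ge 0}$ of rational numbers such that: (1) $q_0 \in \mathbb{Z}$; (2) $q_n \le 1$ for all $n \ge 1$; (3) if $q_1 = 1$ then $q_2 \ne 0$; (4) if $q_m = 0$ for some $m \ge 1$ then $q_n = 0$ for all $n \ge m$; (5) there is $\{a_n\} \in U$ with $q_n = c_n/a_n$ for every $n\ge1$ with $q_n \ne 0$; (6) for every $n \ge 1$, if $q_{n+1} \ne 0$ then $q_{n+2} \ne 0$ or $a_{n+1} > \frac{c_{n+1}}{c_n}a_n(a_n+1)$. (Equivalently, $S$ is the set of coefficient sequences of the generalized alternating-Sylvester expansions $\alpha = q_0 + \sum_{n\ge1}(-1)^{n-1}q_n$ of real numbers with respect to $\{c_n\}$.) Order: for distinct $P=(p_n), Q=(q_n) \in S$ let $i$ be the least index with $p_i \ne q_i$; then $P < Q$ iff $p_0<q_0$ when $i=0$, $p_i < q_i$ when $i$ is odd, and $p_i > q_i$ when $i \ge 2$ is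 even. Rationals: an element of $S$ with $q_m = 0$ for some $m\ge1$ corresponds to the rational $q_0 + \sum_{k\ge1}(-1)^{k-1}q_k$; this is an order-preserving bijection between $\mathbb{Q}$ and these elements, and $\mathbb{Q}$ is regarded as a subset of $S$ in this way. For $X = (x_n) \in S$ and $n\ge1$, $X_n$ denotes the rational $(x_0,x_1,\dots,x_n,0,0,\dots)$, i.e. $x_0 + \sum_{k=1}^n (-1)^{k-1}x_k$. All suprema below are least upper bounds in $(S,<)$ of bounded-above sets of rationals (these exist). Define $0=(0,0,\dots)$, $1=(1,0,0,\dots)$, $X+Y = \sup_n(X_{2n}+Y_{2n})$, $-X = \sup_n(-X_{2n-1})$; $X\cdot Y = \sup_n(X_{2n}Y_{2n})$ if $X,Y\ge0$, $X\cdot Y=(-X)\cdot(-Y)$ if $X,Y\le0$, $X\cdot Y = -((-X)\cdot Y)$ if $X\le0\le Y$, $X\cdot Y = -(X\cdot(-Y))$ if $Y \le 0 \le X$; $X^{-1} = \sup_n((X_{2n-1})^{-1})$ if $X>0$ and $X^{-1} = -((-X)^{-1})$ if $X<0$. *)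

(* Defs.v *)
From HB Require Import structures.
From mathcomp Require Import all_boot all_order all_algebra.
From mathcomp Require Import boolp classical_sets reals.

Set Implicit Arguments.
Unset Strict Implicit.
Unset Printing Implicit Defensive.

Import Order.TTheory GRing.Theory Num.Theory.
Local Open Scope ring_scope.
Local Open Scope classical_set_scope.

(* The sequences (c_n) and (a_n) start at n = 1: the values [c 0] and [a 0]
   are never used. *)

Definition growth_bound (c a : nat -> nat) (n : nat) : rat :=
  (c n.+1)%:R / (c n)%:R * (a n)%:R * ((a n)%:R + 1).

Definition inU (c a : nat -> nat) : Prop :=
  (forall n, (1 <= n)%N -> (0 < a n)%N) /\
  (forall n, (1 <= n)%N -> growth_bound c a n <= (a n.+1)%:R).

Definition inS (c : nat -> nat) (q : nat -> rat) : Prop :=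
  [/\ q 0%N \is a Num.int,
      forall n, (1 <= n)%N -> q n <= 1,
      q 1%N = 1 -> q 2%N <> 0,
      forall m, (1 <= m)%N -> q m = 0 -> forall n, (m <= n)%N -> q n = 0 &
      exists a : nat -> nat,
        [/\ inU c a,
            forall n, (1 <= n)%N -> q n <> 0 -> q n = (c n)%:R / (a n)%:R &
            forall n, (1 <= n)%N -> q n.+1 <> 0 ->
              q n.+2 <> 0 \/ growth_bound c a n < (a n.+1)%:R]].

Record Sseq (c : nat -> nat) :=
  MkS { coef :> nat -> rat ; coef_inS : inS c coef }.

HB.instance Definition _ (c : nat -> nat) := gen_eqMixin (Sseq c).
HB.instance Definition _ (c : nat -> nat) := gen_choiceMixin (Sseq c).

Definition int_seq (z : int) (n : nat) : rat := if n is 0%N then z%:~R else 0.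

Lemma inU_nonempty (c : nat -> nat) : exists a : nat -> nat, inU c a.
Proof.
pose a := fix a n := if n is m.+1 then (c m.+1 * a m * (a m).+1).+1 else 1%N.
exists a; split=> [[|n] //|n _].
rewrite /growth_bound /= -[X in _ <= X]natr1 !natrM -[(a n).+1%:R]natr1.
apply: ler_wpDr => //.
rewrite -!mulrA ler_wpM2l // ler_piMl //; first by rewrite mulr_ge0 // addr_ge0.
case: (c n) => [|k]; first by rewrite invr0.
by rewrite invf_le1 ?ltr0n // ler1n.
Qed.

Lemma int_seq_inS (c : nat -> nat) (z : int) : inS c (int_seq z).
Proof.
split=> [|[|n] //|//|[|m] // _ _ [|n] //|].
  exact: intr_int.
by have [a Ua] := inU_nonempty c; exists a; split=> // [[|n]].
Qed.

Definition Sint (c : nat -> nat) (z : int) : Sseq c := MkS (int_seq_inS c z).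
Definition Szero (c : nat -> nat) : Sseq c := Sint c 0.
Definition Sone (c : nat -> nat) : Sseq c := Sint c 1.

Definition Slt (c : nat -> nat) (P Q : Sseq c) : Prop :=
  exists i : nat,
    [/\ forall j, (j < i)%N -> P j = Q j,
        P i <> Q i &
        if (i == 0%N) || odd i then P i < Q i else Q i < P i].

Definition Sle (c : nat -> nat) (P Q : Sseq c) : Prop := P = Q \/ Slt P Q.

Definition Sis_ub (c : nat -> nat) (A : set (Sseq c)) (b : Sseq c) : Prop :=
  forall x, A x -> Sle x b.

Definition Sis_lub (c : nat -> nat) (A : set (Sseq c)) (s : Sseq c) : Prop :=
  Sis_ub A s /\ forall b, Sis_ub A b -> Sle s b.

(* The rational number X_n. *)
Definition trunc (c : nat -> nat) (X : Sseq c) (n : nat) : rat :=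
  X 0%N + \sum_(1 <= k < n.+1) (-1) ^+ k.-1 * X k.

(* Since the coefficients of [Z] vanish from the index [m] on, [trunc Z m] is
   the full alternating sum. *)
Definition Srepr (c : nat -> nat) (Z : Sseq c) (r : rat) : Prop :=
  exists m : nat, [/\ (1 <= m)%N, Z m = 0 & trunc Z m = r].

(* Each rational is represented by exactly one element of S (for c positive
   with c_n | c_{n+1}), so the default value of [xget] is never taken; the same
   holds in [Ssup] for the bounded-above sequences to which it is applied. *)
Definition Srat (c : nat -> nat) (r : rat) : Sseq c :=
  xget (Szero c) [set Z | Srepr Z r].

Definition Ssup (c : nat -> nat) (u : nat -> rat) : Sseq c :=
  xget (Szero c)
    [set s | Sis_lub [set Z | exists2 n, (1 <= n)%N & Z = Srat c (u n)] s].

Definition Sadd (c : nat -> nat) (X Y : Sseq c) : Sseq c :=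
  Ssup c (fun n => trunc X (2 * n) + trunc Y (2 * n)).

Definition Sopp (c : nat -> nat) (X : Sseq c) : Sseq c :=
  Ssup c (fun n => - trunc X (2 * n - 1)).

Definition Smul_nonneg (c : nat -> nat) (X Y : Sseq c) : Sseq c :=
  Ssup c (fun n => trunc X (2 * n) * trunc Y (2 * n)).

Definition Smul (c : nat -> nat) (X Y : Sseq c) : Sseq c :=
  let z := Szero c in
  if `[< Sle z X /\ Sle z Y >] then Smul_nonneg X Y
  else if `[< Sle X z /\ Sle Y z >] then Smul_nonneg (Sopp X) (Sopp Y)
  else if `[< Sle X z /\ Sle z Y >] then Sopp (Smul_nonneg (Sopp X) Y)
  else Sopp (Smul_nonneg X (Sopp Y)).

Definition Sinv_pos (c : nat -> nat) (X : Sseq c) : Sseq c :=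
  Ssup c (fun n => (trunc X (2 * n - 1))^-1).

(* The value at 0 is a convention: the inverse of 0 is left undefined. *)
Definition Sinv (c : nat -> nat) (X : Sseq c) : Sseq c :=
  let z := Szero c in
  if `[< Slt z X >] then Sinv_pos X
  else if `[< Slt X z >] then Sopp (Sinv_pos (Sopp X))
  else z.

Record ordered_field (T : Type) (zero one : T) (add mul : T -> T -> T)
    (opp inv : T -> T) (lt : T -> T -> Prop) : Prop := OrderedField {
  of_addA : associative add;
  of_addC : commutative add;
  of_add0 : left_id zero add;
  of_addN : left_inverse zero opp add;
  of_mulA : associative mul;
  of_mulC : commutative mul;
  of_mul1 : left_id one mul;
  of_mulV : forall x, x <> zero -> mul (inv x) x = one;
  of_mulDl : left_distributive mul add;
  of_one_neq0 : one <> zero;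
  of_lt_irr : forall x, ~ lt x x;
  of_lt_trans : forall x y z, lt x y -> lt y z -> lt x z;
  of_lt_total : forall x y, [\/ lt x y, x = y | lt y x];
  of_lt_add : forall x y z, lt x y -> lt (add x z) (add y z);
  of_lt_mul : forall x y, lt zero x -> lt zero y -> lt zero (mul x y)
}.

(* Main.v *)
Require Import Defs.
From HB Require Import structures.
From mathcomp Require Import all_boot all_order all_algebra.
From mathcomp Require Import boolp classical_sets reals.
From mathcomp Require Import ring lra Rstruct.

Set Implicit Arguments.
Unset Strict Implicit.
Unset Printing Implicit Defensive.

Import Order.TTheory GRing.Theory Num.Theory.
Local Open Scope ring_scope.
Local Open Scope classical_set_scope.

(** Attach to [X] in [S] the real number [value X] whose partial alternating
    sums are the [X_n]. If the coefficient of index [n] is [c_n / a_n], the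
    growth condition and condition (6) put the remainder [r] left before that
    index in the interval [c_n / (a_n + 1) < r <= c_n / a_n], so that [a_n] is
    the integral part of [c_n / r]: hence [value] is strictly increasing for
    the alternating lexicographic order, and the greedy algorithm inverts it.
    On a rational number the numerators of the remainders decrease, so that
    the expansion stops. Thus [value] is an order isomorphism onto the reals
    that identifies the rationals on both sides, least upper bounds in [S]
    become real suprema, and each operation of [S] is the real one because the
    truncations converge geometrically. *)

(** * Order and truncations in [S]; transport of the field axioms *)

Lemma Sseq_ext (c : nat -> nat) (X Y : Sseq c) : X =1 Y -> X = Y.
Proof.
case: X Y => [x hx] [y hy] /= /funext xy; subst y.
by rewrite (Prop_irrelevance hx hy).
Qed.

Lemma Slt_total (c : nat -> nat) (X Y : Sseq c) : [\/ Slt X Y, X = Y | Slt Y X].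
Proof.
have [[n neq_n]|/forallNP eqXY] := pselect (exists n, X n != Y n); last first.
  by constructor 2; apply: Sseq_ext => n; apply/eqP/negPn/negP/eqXY.
have exn : exists n, X n != Y n by exists n.
case: (ex_minnP exn) => i neqi mini.
have eqlt j : (j < i)%N -> X j = Y j.
  by move=> ltji; apply/eqP/negPn/negP => /mini; rewrite leqNgt ltji.
have [ltXY|ltYX|eqXY] := ltgtP (X i) (Y i); last by rewrite eqXY eqxx in neqi.
- case b: ((i == 0%N) || odd i).
    by constructor 1; exists i; split; rewrite ?b //; apply/eqP.
  constructor 3; exists i; rewrite b; split=> [j /eqlt //||//].
  by apply/eqP; rewrite eq_sym.
- case b: ((i == 0%N) || odd i).
    constructor 3; exists i; rewrite b; split=> [j /eqlt //||//].
    by apply/eqP; rewrite eq_sym.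
  by constructor 1; exists i; rewrite b; split=> //; apply/eqP.
Qed.

Lemma truncS (c : nat -> nat) (X : Sseq c) n :
  trunc X n.+1 = trunc X n + (-1) ^+ n * X n.+1.
Proof. by rewrite /trunc big_nat_recr //= addrA. Qed.

Lemma trunc0 (c : nat -> nat) (X : Sseq c) : trunc X 0 = X 0%N.
Proof. by rewrite /trunc big_geq // addr0. Qed.

Lemma eq_trunc (c : nat -> nat) (X Y : Sseq c) n :
  (forall j, (j <= n)%N -> X j = Y j) -> trunc X n = trunc Y n.
Proof.
elim: n => [|n IHn] eqXY; first by rewrite !trunc0 eqXY.
by rewrite !truncS eqXY // IHn // => j /leqW /eqXY.
Qed.

Lemma le_of_half_exp (R : realType) (x y K : R) : 0 <= K ->
  (forall n, (1 <= n)%N -> x <= y + K * 2^-1 ^+ n) -> x <= y.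
Proof.
move=> K0 h; rewrite leNgt; apply/negP => ltyx.
have d0 : 0 < x - y by rewrite subr_gt0.
(* With this [n], [2 ^ n] exceeds [K / (x - y)]; the successor ensures [1 <= n]. *)
pose n := (Num.bound (K / (x - y))).+1.
have := @upper_nthrootP _ (K / (x - y)) n (leqnSn _).
have := h n isT; rewrite exprVn ltr_pdivrMr // => hn; apply/negP; rewrite -leNgt.
have e0 : 0 < (2 : R) ^+ n by rewrite exprn_gt0.
by rewrite mulrC -ler_pdivlMr // lerBlDl.
Qed.

Lemma ordered_field_transfer (T : Type) (R : realFieldType) (zero one : T)
    (add mul : T -> T -> T) (opp inv : T -> T) (lt : T -> T -> Prop)
    (f : T -> R) :
  injective f -> f zero = 0 -> f one = 1 ->
  (forall x y, f (add x y) = f x + f y) ->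
  (forall x y, f (mul x y) = f x * f y) ->
  (forall x, f (opp x) = - f x) -> (forall x, f (inv x) = (f x)^-1) ->
  (forall x y, lt x y <-> f x < f y) ->
  ordered_field zero one add mul opp inv lt.
Proof.
move=> inj f0 f1 fD fM fN fV flt.
split=> [x y z|x y|x|x|x y z|x y|x|x x0|x y z||x|x y z|x y|x y z|x y].
- by apply: inj; rewrite !fD addrA.
- by apply: inj; rewrite !fD addrC.
- by apply: inj; rewrite fD f0 add0r.
- by apply: inj; rewrite fD fN f0 addNr.
- by apply: inj; rewrite !fM mulrA.
- by apply: inj; rewrite !fM mulrC.
- by apply: inj; rewrite fM f1 mul1r.
- apply: (inj); rewrite fM fV f1 mulVf //; apply/eqP => fx0.
  by case: x0; apply: inj; rewrite f0.
- by apply: inj; rewrite !(fD, fM) mulrDl.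
- by move/(congr1 f)/eqP; rewrite f0 f1 oner_eq0.
- by rewrite flt ltxx.
- by rewrite !flt; apply: lt_trans.
- case: (ltgtP (f x) (f y)) => [/flt|/flt|/inj];
  by [constructor 1|constructor 3|constructor 2].
- by rewrite !flt !fD ltrD2r.
- by rewrite !flt fM f0; apply: mulr_gt0.
Qed.

(** * Decay of the coefficients and the alternating-series estimate *)

Section Value.
Variables (c : nat -> nat).
Hypothesis c_gt0 : forall n : nat, (1 <= n)%N -> (0 < c n)%N.
Hypothesis c_dvd : forall n : nat, (1 <= n)%N -> (c n %| c n.+1)%N.

(** The growth condition and condition (6) in inverted form: the gap [c/a - c/(a+1) = c/(a(a+1))] is
    the next [c] divided by the growth bound, so it dominates the next coefficient. *)
Lemma coefP (X : Sseq c) : exists a : nat -> nat,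
  [/\ forall n, (0 < a n.+1)%N,
      forall n, X n.+1 <> 0 -> X n.+1 = (c n.+1)%:R / (a n.+1)%:R,
      forall n, X n.+1 <> 0 -> X n.+2 <=
        (c n.+1)%:R / (a n.+1)%:R - (c n.+1)%:R / ((a n.+1)%:R + 1) &
      forall n, X n.+1 <> 0 -> X n.+3 = 0 -> X n.+2 <
        (c n.+1)%:R / (a n.+1)%:R - (c n.+1)%:R / ((a n.+1)%:R + 1)].
Proof.
have [_ _ _ X0 [a [[a_gt0 a_ge] Xa Xlt]]] := coef_inS X.
exists a; split=> [n|n|n Xn|n Xn Xn3]; [exact: a_gt0|exact: Xa| |].
all: have an : 0 < (a n.+1)%:R :> rat by rewrite ltr0n a_gt0.
all: have an2 : 0 < (a n.+2)%:R :> rat by rewrite ltr0n a_gt0.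
all: have cn : 0 < (c n.+1)%:R :> rat by rewrite ltr0n c_gt0.
all: have cn2 : 0 < (c n.+2)%:R :> rat by rewrite ltr0n c_gt0.
all: have -> : (c n.+1)%:R / (a n.+1)%:R - (c n.+1)%:R / ((a n.+1)%:R + 1)
  = (c n.+2)%:R / growth_bound c a n.+1 :> rat
  by rewrite /growth_bound; field; rewrite !gt_eqF //= ltr_wpDr.
all: have gb : 0 < growth_bound c a n.+1
  by rewrite /growth_bound !mulr_gt0 ?invr_gt0 ?ltr_wpDr.
all: have q0 := divr_gt0 cn2 gb.
all: have [->|/eqP Xn2] := eqVneq (X n.+2) 0; rewrite ?(ltW q0) //.
- by rewrite Xa // ler_pM2l // lef_pV2 ?posrE // a_ge.
- rewrite Xa // ltr_pM2l // ltf_pV2 ?posrE //.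
  by case: (Xlt n.+1 isT Xn2).
Qed.

Lemma coef_ge0 (X : Sseq c) n : 0 <= X n.+1.
Proof.
have [a [_ Xa _ _]] := coefP X.
by have [-> //|/eqP/Xa ->] := eqVneq (X n.+1) 0; rewrite divr_ge0.
Qed.

(** The gap [1/a - 1/(a+1) = 1/(a(a+1))] is at most [1/(2a)] because [a >= 1]. *)
Lemma coef_le_half (X : Sseq c) n : X n.+2 <= X n.+1 * 2^-1.
Proof.
have [a [a0 Xa Xle _]] := coefP X.
have [X0|/eqP Xn] := eqVneq (X n.+1) 0.
  have [_ _ _ X0n _] := coef_inS X.
  by rewrite X0 mul0r (X0n n.+1).
apply: le_trans (Xle n Xn) _; rewrite (Xa n Xn).
have an : 1 <= (a n.+1)%:R :> rat by rewrite ler1n.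
have cn : 0 <= (c n.+1)%:R :> rat by [].
rewrite -mulrBr -mulrA ler_wpM2l // lerBlDl -lerBlDr.
have -> : (a n.+1)%:R^-1 - (a n.+1)%:R^-1 / 2 = (2 * (a n.+1)%:R)^-1 :> rat.
  by field; rewrite gt_eqF //; lra.
by rewrite lef_pV2 ?posrE; lra.
Qed.

Lemma coef_le1 (X : Sseq c) n : X n.+1 <= 1.
Proof. by have [_ X1 _ _ _] := coef_inS X; exact: X1. Qed.

Lemma coef_le_exp (X : Sseq c) n : X n.+1 <= 2^-1 ^+ n.
Proof.
elim: n => [|n IHn]; first by rewrite expr0 coef_le1.
by apply: le_trans (coef_le_half X n) _; rewrite exprSr ler_wpM2r.
Qed.

(** Leibniz estimate: a partial tail is its first term minus the partial tail one index later, which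
    the induction bounds by a smaller coefficient. *)
Lemma trunc_itv (X : Sseq c) n k :
  0 <= (-1) ^+ n * (trunc X (n + k) - trunc X n) <= X n.+1.
Proof.
elim: k n => [|k IHk] n; first by rewrite addn0 subrr mulr0 lexx coef_ge0.
have -> : (-1) ^+ n * (trunc X (n + k.+1) - trunc X n) =
    X n.+1 - (-1) ^+ n.+1 * (trunc X (n.+1 + k) - trunc X n.+1).
  have s1 : (-1) ^+ n * (-1) ^+ n = 1 :> rat by rewrite -expr2 sqrr_sign.
  rewrite addSnnS truncS exprS; set s := _ ^+ n in s1 *.
  ring: s1.
have := IHk n.+1; have := coef_le_half X n; have := coef_ge0 X n.
lra.
Qed.

(** * The value of a sequence, its remainders, and strict monotonicity *)

Section Real.
Variable R : realType.
Implicit Types X Y : Sseq c.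

Definition value X : R := sup [set x | exists n, x = ratr (trunc X (2 * n))].

(** The tail [X (n+1) - X (n+2) + ...]; the sign makes it nonnegative at every index. *)
Definition remainder X n : R := (-1) ^+ n * (value X - ratr (trunc X n)).

Lemma remainder_ge0 X n : 0 <= remainder X n.
Proof.
(* Even truncations lie below odd ones, whichever of the two is longer. *)
have ubodd k m : odd k -> trunc X (2 * m) <= trunc X k.
  move=> k1; have [lekm|/ltnW lemk] := leqP k (2 * m).
    have := trunc_itv X k (2 * m - k).
    by rewrite subnKC // -signr_odd k1 expr1 => /andP[]; lra.
  have := trunc_itv X (2 * m) (k - 2 * m).
  by rewrite subnKC // -signr_odd oddM /= expr0 => /andP[]; lra.
have nz : [set x : R | exists n, x = ratr (trunc X (2 * n))] !=set0.
  by exists (ratr (trunc X (2 * 0))), 0%N.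
rewrite /remainder -signr_odd; case: (boolP (odd n)) => n1.
  rewrite expr1 mulN1r opprB subr_ge0; apply: ge_sup => // _ [m ->].
  by rewrite ler_rat ubodd.
rewrite expr0 mul1r subr_ge0; apply: ub_le_sup.
  by exists (ratr (trunc X 1)) => _ [m ->]; rewrite ler_rat ubodd.
by exists n./2; rewrite mul2n even_halfK.
Qed.

Lemma remainderS X n : remainder X n = ratr (X n.+1) - remainder X n.+1.
Proof.
have s1 : (-1) ^+ n * (-1) ^+ n = 1 :> R by rewrite -expr2 sqrr_sign.
rewrite /remainder truncS (rmorphD _ (trunc X n)) /= rmorphM /= rmorph_sign exprS.
set s := _ ^+ n in s1 *; ring: s1.
Qed.

Lemma remainder_le X n : remainder X n <= ratr (X n.+1).
Proof. by rewrite remainderS lerBlDr lerDl remainder_ge0. Qed.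

Lemma remainder_gt0 X n : X n.+1 <> 0 -> 0 < remainder X n.
Proof.
move=> /eqP Xn; rewrite remainderS subr_gt0.
apply: le_lt_trans (remainder_le _ _) _; rewrite ltr_rat.
have := coef_ge0 X n; rewrite le_eqVlt eq_sym (negPf Xn) /=.
by have := coef_le_half X n; lra.
Qed.

(** Condition (3) excludes a fractional part equal to 1, so [X 0] is the floor of the value. *)
Lemma remainder0_lt1 X : remainder X 0 < 1.
Proof.
have [X1|X1] := eqVneq (X 1%N) 1.
  have [_ _ /(_ X1) X2 _ _] := coef_inS X.
  by rewrite remainderS X1 rmorph1; have := remainder_gt0 X2; lra.
apply: le_lt_trans (remainder_le X 0) _.
by rewrite -[ltRHS](rmorph1 (@ratr R)) ltr_rat lt_neqAle X1 coef_le1.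
Qed.

Lemma value_itv X : 0 <= value X - ratr (X 0%N) < 1.
Proof.
have := remainder0_lt1 X; have := remainder_ge0 X 0.
by rewrite /remainder trunc0 expr0 mul1r => -> ->.
Qed.

(* A nonzero coefficient [c / a] is determined by its remainder [r], since
   [a] is the integral part of [c / r]; the strictness of the lower bound is
   condition (6). *)
Lemma remainder_lt X Y n : X n.+1 < Y n.+1 -> remainder X n < remainder Y n.
Proof.
move=> ltXY.
have Yn : Y n.+1 <> 0 by apply/eqP; rewrite gt_eqF // (le_lt_trans _ ltXY) // coef_ge0.
have [b [b0 Yb Yle Ylt]] := coefP Y.
have cn : 0 < (c n.+1)%:R :> rat by rewrite ltr0n c_gt0.
have remY : ratr ((c n.+1)%:R / ((b n.+1)%:R + 1)) < remainder Y n.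
  rewrite remainderS (Yb _ Yn).
  (* Strictness comes from condition (6) if the expansion stops here, and otherwise from the next
     remainder being positive. *)
  have [Y3|/eqP Y3] := eqVneq (Y n.+3) 0.
    have := Ylt n Yn Y3; rewrite -(ltr_rat R) rmorphB /= => h.
    by have := remainder_le Y n.+1; lra.
  have := Yle n Yn; rewrite -(ler_rat R) rmorphB /= => h.
  by have := remainder_gt0 Y3; have := remainderS Y n.+1; lra.
have [X0|/eqP Xn] := eqVneq (X n.+1) 0.
  by apply: le_lt_trans (remainder_le X n) _; rewrite X0 rmorph0 remainder_gt0.
have [a [a0 Xa _ _]] := coefP X.
apply: le_lt_trans (remainder_le X n) (le_lt_trans _ remY).
(* Denominators are integers: [b < a] gives [b + 1 <= a]. *)
rewrite ler_rat Xa // ler_pM2l // natr1 lef_pV2 ?posrE ?ltr0n // ler_nat.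
by move: ltXY; rewrite Xa // Yb // ltr_pM2l // ltf_pV2 ?posrE ?ltr0n // ltr_nat.
Qed.

Lemma value_remainder X n :
  value X = ratr (trunc X n) + (-1) ^+ n * remainder X n.
Proof. by rewrite /remainder mulrA -expr2 sqrr_sign mul1r addrC subrK. Qed.

(** At index 0 distinct integers differ by at least 1, more than the fractional parts can
    compensate. Later, the common truncation cancels and the sign of the remainder matches the
    alternation of the order. *)
Lemma Slt_value_lt X Y : Slt X Y -> value X < value Y.
Proof.
case=> -[|i] [eqXY neqXY /=].
  have [X0 _ _ _ _] := coef_inS X; have [Y0 _ _ _ _] := coef_inS Y.
  rewrite -(ltr_rat R) => lt0.
  have /andP[_ hX] := value_itv X; have /andP[hY _] := value_itv Y.
  suff : (ratr (X 0%N) : R) + 1 <= ratr (Y 0%N) by lra.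
  move: lt0; rewrite ltr_rat.
  case/intrP: X0 => x ->; case/intrP: Y0 => y ->.
  by rewrite !ratr_int ltr_int -lezD1 -(ler_int R) rmorphD.
have eqt : trunc X i = trunc Y i by apply: eq_trunc => j; rewrite -ltnS; exact: eqXY.
rewrite (value_remainder X i) (value_remainder Y i) eqt -signr_odd ltrD2l.
case: (odd i) => /= /remainder_lt; rewrite ?expr1 ?expr0; lra.
Qed.

Lemma Slt_value X Y : Slt X Y <-> value X < value Y.
Proof.
split; first exact: Slt_value_lt.
case: (Slt_total X Y) => [//|->|/Slt_value_lt]; first by rewrite ltxx.
by move=> h1 h2; have := lt_trans h1 h2; rewrite ltxx.
Qed.

Lemma value_inj : injective value.
Proof.
move=> X Y eqv; case: (Slt_total X Y) => [/Slt_value|//|/Slt_value];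
by rewrite eqv ltxx.
Qed.

Lemma Sle_value X Y : Sle X Y <-> value X <= value Y.
Proof.
rewrite le_eqVlt; split=> [[->|/Slt_value ->]|]; rewrite ?eqxx ?orbT //.
by case/orP=> [/eqP/value_inj|/Slt_value]; [left|right].
Qed.

(** * Geometric convergence of the truncations *)

Lemma half_exp_le m n : (n <= m)%N -> (2^-1 : R) ^+ m <= 2^-1 ^+ n.
Proof. by move=> lenm; apply: ler_wiXn2l => //; lra. Qed.

Lemma remainder_le_exp X n : remainder X n <= 2^-1 ^+ n.
Proof.
apply: le_trans (remainder_le X n) _.
have := coef_le_exp X n; rewrite -(ler_rat R) => /le_trans -> //.
by rewrite rmorphXn /= fmorphV /= ratr_nat.
Qed.

Lemma trunc_even_itv X n :
  value X - 2^-1 ^+ n <= ratr (trunc X (2 * n)) <= value X.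
Proof.
rewrite (value_remainder X (2 * n)) -signr_odd oddM /= expr0 mul1r.
have := remainder_ge0 X (2 * n); have := remainder_le_exp X (2 * n).
have /half_exp_le : (n <= 2 * n)%N by rewrite leq_pmull.
by lra.
Qed.

Lemma trunc_odd_itv X n : (1 <= n)%N ->
  value X <= ratr (trunc X (2 * n - 1)) <= value X + 2^-1 ^+ n.
Proof.
move=> n1; rewrite (value_remainder X (2 * n - 1)) -signr_odd.
rewrite oddB ?muln_gt0 // oddM /= expr1 mulN1r.
have := remainder_ge0 X (2 * n - 1); have := remainder_le_exp X (2 * n - 1).
have /half_exp_le : (n <= 2 * n - 1)%N by rewrite mul2n -addnn -addnBA // leq_addr.
by lra.
Qed.

Lemma value_unique X v :
  (forall n, 0 <= (-1) ^+ n * (v - ratr (trunc X n))) -> value X = v.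
Proof.
move=> h; apply: le_anti; apply/andP; split;
  apply: (@le_of_half_exp _ _ _ 1) => // n n1; rewrite mul1r.
  have := h (2 * n)%N; rewrite -signr_odd oddM /= expr0.
  by have := trunc_even_itv X n; lra.
have := h (2 * n - 1)%N; rewrite -signr_odd oddB ?muln_gt0 // oddM /= expr1.
by have := trunc_odd_itv X n1; lra.
Qed.

(** * The greedy expansion of a real number *)

Section Greedy.
Variable v : R.

(* At step [n] the first component is the remainder still to be expanded and
   the second one is the denominator of the coefficient of index [n.+1]; when
   the remainder vanishes, the denominator only has to satisfy the growth
   condition. *)
Fixpoint greedy n : R * nat :=
  if n is m.+1 then
    let x := (greedy m).1 in let a := (greedy m).2 in
    let y := if x == 0 then 0 else (c m.+1)%:R / a%:R - x in
    (y, if y == 0 then (c m.+2 %/ c m.+1 * a * a.+1)%N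
        else Num.truncn ((c m.+2)%:R / y))
  else
    let x := v - (Num.floor v)%:~R in
    (x, if x == 0 then c 1%N else Num.truncn ((c 1%N)%:R / x)).

Definition grem n := (greedy n).1.
Definition gden n := (greedy n).2.
(** The growth bound as a natural number; the division is exact since [c n.+1] divides [c n.+2]. *)
Definition gmin n := (c n.+2 %/ c n.+1 * gden n * (gden n).+1)%N.

Lemma gremS n : grem n.+1 =
  if grem n == 0 then 0 else (c n.+1)%:R / (gden n)%:R - grem n.
Proof. by []. Qed.

Lemma gdenS n : gden n.+1 =
  if grem n.+1 == 0 then gmin n else Num.truncn ((c n.+2)%:R / grem n.+1).
Proof. by []. Qed.

Lemma c_divn_mul n : (c n.+2 = c n.+2 %/ c n.+1 * c n.+1)%N.
Proof. by rewrite divnK // c_dvd. Qed.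

Lemma truncn_div_itv (k : nat) (x : R) : 0 < x -> (0 < k)%N ->
  (0 < Num.truncn (k%:R / x))%N ->
  k%:R / (Num.truncn (k%:R / x)).+1%:R < x <= k%:R / (Num.truncn (k%:R / x))%:R.
Proof.
move=> x0 k0 a0.
have kx : 0 <= k%:R / x by rewrite divr_ge0 // ltW.
have /andP[h1 h2] := truncn_itv kx.
rewrite ltr_pdivrMr ?ltr0n // mulrC -ltr_pdivrMr // h2 /=.
by rewrite ler_pdivlMr ?ltr0n // mulrC -ler_pdivlMr.
Qed.

Lemma grem0_lt1 : grem 0 < 1.
Proof.
by have /andP[_] := floor_itv v; rewrite /grem /= rmorphD /= ltrBlDl.
Qed.

(** From [c/(a+1) < x] the next remainder [c/a - x] is below [c/(a(a+1))], which is [c n.+2] over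
    [gmin n]. *)
Lemma gremS_lt n : (0 < gden n)%N ->
  (grem n != 0 -> (c n.+1)%:R / (gden n).+1%:R < grem n) ->
  grem n.+1 * (gmin n)%:R < (c n.+2)%:R.
Proof.
move=> d0 hx; rewrite gremS.
case: eqVneq => [_|/hx {}hx]; first by rewrite mul0r ltr0n c_gt0.
have dR : 0 < (gden n)%:R :> R by rewrite ltr0n.
have dR1 : 0 < (gden n).+1%:R :> R by rewrite ltr0n.
have cR : 0 < (c n.+1)%:R :> R by rewrite ltr0n c_gt0.
have k0 : 0 < (c n.+2 %/ c n.+1)%:R :> R.
  by rewrite ltr0n divn_gt0 ?c_gt0 // dvdn_leq ?c_gt0 // c_dvd.
rewrite [in ltRHS]c_divn_mul /gmin !natrM -mulrA mulrCA ltr_pM2l //.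
apply: lt_le_trans (_ : ((c n.+1)%:R / (gden n)%:R - (c n.+1)%:R / (gden n).+1%:R) *
    ((gden n)%:R * (gden n).+1%:R) <= _).
  by rewrite ltr_pM2r ?mulr_gt0 // ltrD2l ltrN2.
rewrite le_eqVlt; apply/orP; left; apply/eqP; rewrite -natr1.
by field; rewrite natr1 !gt_eqF.
Qed.

Lemma gdenS_ge n : 0 <= grem n.+1 -> grem n.+1 * (gmin n)%:R < (c n.+2)%:R ->
  (gmin n <= gden n.+1)%N.
Proof.
move=> y0 ym; rewrite gdenS; case: eqVneq => // yn0.
have yp : 0 < grem n.+1 by rewrite lt_def yn0.
by rewrite truncn_ge_nat ?divr_ge0 // ler_pdivlMr // mulrC ltW.
Qed.

(** The three facts sustain each other: [c <= a] makes the denominator positive, the upper bound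
    keeps the next remainder nonnegative, and the lower bound pushes the next denominator up to
    [gmin], hence up to the next [c]. *)
Lemma greedyP n :
  [/\ 0 <= grem n, (c n.+1 <= gden n)%N &
      grem n != 0 ->
      (c n.+1)%:R / (gden n).+1%:R < grem n <= (c n.+1)%:R / (gden n)%:R].
Proof.
have c0 k : (0 < c k.+1)%N by exact: c_gt0.
have cR k : 0 < (c k.+1)%:R :> R by rewrite ltr0n.
elim: n => [|n [x0 cd hx]].
  have x0 : 0 <= grem 0 by rewrite /grem /= subr_ge0 ge_floor.
  have x1 := grem0_lt1.
  have cd : (c 1 <= gden 0)%N.
    rewrite /gden /= -/(grem 0); case: eqVneq => // xn0.
    have xp : 0 < grem 0 by rewrite lt_def xn0.
    rewrite truncn_ge_nat ?divr_ge0 // ler_pdivlMr //.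
    by rewrite ler_piMr // ltW.
  split=> // xn0; have xp : 0 < grem 0 by rewrite lt_def xn0.
  move: cd; rewrite /gden /= -/(grem 0) (negPf xn0) => cd.
  by apply: truncn_div_itv => //; apply: leq_trans cd.
have d0 : (0 < gden n)%N by apply: leq_trans cd.
have cm : (c n.+2 <= gmin n)%N.
  rewrite [leqLHS]c_divn_mul /gmin -mulnA leq_mul2l; apply/orP; right.
  by rewrite (leq_trans cd) // leq_pmulr.
have y0 : 0 <= grem n.+1.
  by rewrite gremS; case: eqVneq => // /hx /andP[_]; rewrite subr_ge0.
have ym : grem n.+1 * (gmin n)%:R < (c n.+2)%:R.
  by apply: gremS_lt => // /hx /andP[].
have cd' : (c n.+2 <= gden n.+1)%N.
  by apply: leq_trans cm (gdenS_ge y0 ym).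
split=> // yn0; have yp : 0 < grem n.+1 by rewrite lt_def yn0.
move: cd'; rewrite gdenS (negPf yn0) => cd'.
by apply: truncn_div_itv => //; apply: leq_trans cd'.
Qed.

Lemma gden_gt0 n : (0 < gden n)%N.
Proof. by have [_ cd _] := greedyP n; apply: leq_trans cd; exact: c_gt0. Qed.

Lemma gmin_le n : (gmin n <= gden n.+1)%N.
Proof.
have [y0 _ _] := greedyP n.+1; apply: gdenS_ge => //.
by apply: gremS_lt => [|]; [exact: gden_gt0|have [_ _ h] := greedyP n => /h /andP[]].
Qed.

Lemma grem_next_eq0 n : grem n != 0 -> grem n.+1 = 0 ->
  grem n = (c n.+1)%:R / (gden n)%:R.
Proof. by rewrite gremS => /negPf -> /eqP; rewrite subr_eq0 => /eqP. Qed.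

(** This yields condition (6): when the expansion stops, the last remainder equals its coefficient,
    and the strict bound on remainders passes to denominators. *)
Lemma gmin_lt n : grem n.+1 != 0 -> grem n.+2 = 0 -> (gmin n < gden n.+1)%N.
Proof.
move=> yn0 /(grem_next_eq0 yn0) yE; have := gremS_lt (gden_gt0 n).
have [_ _ h] := greedyP n => /(_ (fun p => proj1 (andP (h p)))).
have dR : 0 < (gden n.+1)%:R :> R by rewrite ltr0n gden_gt0.
rewrite yE mulrAC ltr_pdivrMr // ltr_pM2l ?ltr_nat //.
by rewrite ltr0n c_gt0.
Qed.

Definition gcoef n : rat :=
  if n is m.+1 then if grem m == 0 then 0 else (c n)%:R / (gden m)%:R
  else (Num.floor v)%:~R.

Lemma gcoef_eq0 n : (gcoef n.+1 == 0) = (grem n == 0).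
Proof.
rewrite /gcoef; case: (eqVneq (grem n) 0) => [_|_]; first by rewrite eqxx.
by apply: gt_eqF; rewrite divr_gt0 // ltr0n ?gden_gt0 ?c_gt0.
Qed.

Lemma gcoef_inS : inS c gcoef.
Proof.
have growthE n : growth_bound c (fun k => gden k.-1) n.+1 = (gmin n)%:R.
  rewrite /growth_bound /gmin /= [in LHS]c_divn_mul !natrM natr1.
  by rewrite mulfK // pnatr_eq0 -lt0n c_gt0.
split.
- exact: intr_int.
- case=> // n _; rewrite /gcoef; case: eqVneq => // _.
  have [_ cd _] := greedyP n.
  by rewrite ler_pdivrMr ?ltr0n ?gden_gt0 // mul1r ler_nat.
- move=> q1 /eqP; rewrite gcoef_eq0 => /eqP g1.
  have g0 : grem 0 != 0 by rewrite -gcoef_eq0 q1 oner_eq0.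
  (* If [q 1 = 1] and [q 2 = 0], the fractional part of [v] would be 1. *)
  have := grem0_lt1; rewrite (grem_next_eq0 g0 g1).
  move: q1; rewrite /gcoef (negPf g0) => /(congr1 (@ratr R)).
  by rewrite fmorph_div /= !ratr_nat rmorph1 => ->; rewrite ltxx.
- case=> // m _ /eqP; rewrite gcoef_eq0 => /eqP gm n ltmn.
  suff /eqP : grem n.-1 = 0 by case: n ltmn => // n _; rewrite -gcoef_eq0 => /eqP.
  case: n ltmn => // n; rewrite ltnS /=.
  elim: n => [|n IHn]; first by rewrite leqn0 => /eqP <-.
  by rewrite leq_eqVlt => /predU1P[<- //|/IHn g0]; rewrite gremS g0 eqxx.
(* The shift is needed because [gden m] is the denominator of index [m.+1]. *)
- exists (fun k => gden k.-1); split.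
  + split=> [n _|[|n] // _]; first exact: gden_gt0.
    by rewrite growthE ler_nat gmin_le.
  + by case=> // n _ /eqP; rewrite gcoef_eq0 /gcoef => /negPf ->.
  + case=> // n _ /eqP; rewrite gcoef_eq0 => g1.
    have [g2|g2] := eqVneq (grem n.+2) 0; last by left; apply/eqP; rewrite gcoef_eq0.
    by right; rewrite growthE ltr_nat gmin_lt.
Qed.

Definition expansion : Sseq c := MkS gcoef_inS.

(** Both sides start at the fractional part of [v] and satisfy [r (n+1) = q (n+1) - r n], also once
    the remainder is zero. *)
Lemma gremE n : (-1) ^+ n * (v - ratr (trunc expansion n)) = grem n.
Proof.
elim: n => [|n IHn]; first by rewrite expr0 mul1r trunc0 /= ratr_int.
have -> : grem n.+1 = ratr (gcoef n.+1) - grem n.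
  rewrite gremS /gcoef; case: eqVneq => [->|_]; first by rewrite rmorph0 subr0.
  by rewrite fmorph_div /= !ratr_nat.
have s1 : (-1) ^+ n * (-1) ^+ n = 1 :> R by rewrite -expr2 sqrr_sign.
rewrite -IHn truncS (rmorphD _ (trunc expansion n)) /= rmorphM /= rmorph_sign exprS.
by set s := _ ^+ n in s1 *; ring: s1.
Qed.

Lemma value_expansion : value expansion = v.
Proof. by apply: value_unique => n; rewrite gremE; case: (greedyP n). Qed.

(* Euclid: a remainder [s / t] is followed by [(c * t - a * s) / (a * t)], and
   the new numerator is [c * t] modulo [s]. *)
Lemma grem_rat_terminates s t n : (0 < t)%N -> grem n = s%:R / t%:R ->
  exists m, grem m = 0.
Proof.
elim/ltn_ind: s t n => s IHs t n t0 gE.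
have [g0|gn0] := eqVneq (grem n) 0; first by exists n.
have d0 := gden_gt0 n.
have [_ _ /(_ gn0)] := greedyP n; rewrite gE.
have tR : 0 < t%:R :> R by rewrite ltr0n.
have dR : 0 < (gden n)%:R :> R by rewrite ltr0n.
rewrite ltr_pdivrMr ?ltr0n // mulrAC ltr_pdivlMr // -!natrM ltr_nat.
rewrite ler_pdivrMr // mulrAC ler_pdivlMr // -!natrM ler_nat => /andP[lt1 le1].
apply: (IHs (c n.+1 * t - s * gden n)%N _ (gden n * t)%N n.+1).
- by rewrite ltn_subLR // -mulnSr.
- by rewrite muln_gt0 d0.
- rewrite gremS (negPf gn0) gE natrB // !natrM.
  by field; rewrite !gt_eqF.
Qed.

End Greedy.

(** * Rationals and suprema inside [S] *)

Lemma Srepr_value (Z : Sseq c) r : Srepr Z r -> value Z = ratr r.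
Proof.
case=> m [m1 Zm <-]; rewrite (value_remainder Z m).
have [_ _ _ Z0 _] := coef_inS Z.
have : remainder Z m = 0; last by move=> ->; rewrite mulr0 addr0.
apply: le_anti; rewrite remainder_ge0 andbT.
by apply: le_trans (remainder_le Z m) _; rewrite (Z0 m) ?rmorph0.
Qed.

Lemma Srepr_expansion r : Srepr (expansion (ratr r)) r.
Proof.
have [m gm] : exists m, grem (ratr r) m = 0.
  pose q := r - (Num.floor (ratr r : R))%:~R.
  have gq : grem (ratr r) 0 = ratr q by rewrite /q rmorphB /= ratr_int.
  have q0 : 0 <= q by rewrite -(ler0q R) -gq; case: (greedyP (ratr r) 0).
  apply: (@grem_rat_terminates _ `|numq q| `|denq q| 0%N).
    by rewrite absz_gt0 denq_neq0.
  rewrite gq -[in LHS](divq_num_den q) fmorph_div /= !ratr_int.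
  by rewrite !natr_absz ger0_norm ?numq_ge0 // ger0_norm ?denq_ge0.
(* A zero remainder at [m] kills the coefficient at [m.+1], an index that is at least 1 as [Srepr]
   requires. *)
have gm1 : grem (ratr r) m.+1 = 0 by rewrite gremS gm eqxx.
exists m.+1; split=> //.
  by apply/eqP; rewrite gcoef_eq0 gm.
have := gremE (ratr r) m.+1; rewrite gm1 => /eqP.
by rewrite mulf_eq0 signr_eq0 /= subr_eq0 => /eqP /fmorph_inj.
Qed.

Lemma value_Srat r : value (Srat c r) = ratr r.
Proof.
apply: Srepr_value; rewrite /Srat.
by case: xgetP => [_ -> //|/(_ (expansion (ratr r)))/(_ (Srepr_expansion r))].
Qed.

Lemma Sint_value z : value (Sint c z) = z%:~R.
Proof.
rewrite -ratr_int; apply: Srepr_value; exists 1%N; split=> //.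
by rewrite truncS trunc0 /= mulr0 addr0.
Qed.

(** The geometric rate forces every upper bound of the [u n] to be at least [w]. So the expansion of
    [w] is a least upper bound, [xget] does not return its default, and uniqueness of least upper
    bounds identifies its choice. *)
Lemma Ssup_value (u : nat -> rat) (w K : R) : 0 <= K ->
  (forall n, (1 <= n)%N -> w - K * 2^-1 ^+ n <= ratr (u n) <= w) ->
  value (Ssup c u) = w.
Proof.
move=> K0 hu; set A := [set Z | exists2 n, (1 <= n)%N & Z = Srat c (u n)].
have lub_w : Sis_lub A (expansion w).
  split=> [_ [n n1 ->]|b ub].
    by apply/Sle_value; rewrite value_Srat value_expansion; case/andP: (hu n n1).
  apply/Sle_value; rewrite value_expansion; apply: (le_of_half_exp K0) => n n1.
  have /Sle_value : Sle (Srat c (u n)) b by apply: ub; exists n.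
  by rewrite value_Srat; have := hu n n1; lra.
rewrite -(value_expansion w); congr value; rewrite /Ssup -/A.
case: xgetP => [s _ [ubs lubs]|/(_ _ lub_w) //]; case: lub_w => ubw lubw.
apply: value_inj; apply: le_anti.
by apply/andP; split; apply/Sle_value; [apply: lubs|apply: lubw].
Qed.

(** * The operations of [S] computed in the reals *)

Lemma value_Sadd X Y : value (Sadd X Y) = value X + value Y.
Proof.
apply: (@Ssup_value _ _ 2) => // n n1; rewrite rmorphD /=.
by have := trunc_even_itv X n; have := trunc_even_itv Y n; lra.
Qed.

Lemma value_Sopp X : value (Sopp X) = - value X.
Proof.
apply: (@Ssup_value _ _ 1) => // n n1; rewrite rmorphN /=.
by have := trunc_odd_itv X n1; lra.
Qed.

(** A nonnegative value has a nonnegative floor [X 0], and no truncation goes below [X 0]. *)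
Lemma trunc_even_ge0 X n : 0 <= value X -> 0 <= ratr (trunc X (2 * n)) :> R.
Proof.
move=> vX.
have X0 : 0 <= X 0%N.
  have /andP[_] := value_itv X; have [/intrP[z ->] _ _ _ _] := coef_inS X.
  by rewrite ratr_int ler0z -ltzD1 -(ltr_int R) rmorphD /=; lra.
have := trunc_itv X 0 (2 * n); rewrite expr0 mul1r add0n trunc0 ler0q; lra.
Qed.

Lemma value_Smul_nonneg X Y : 0 <= value X -> 0 <= value Y ->
  value (Smul_nonneg X Y) = value X * value Y.
Proof.
(* With [x], [y] the truncations, the error is [(value X - x) * value Y + x * (value Y - y)], and
   [x <= value X]. *)
move=> X0 Y0; apply: (@Ssup_value _ _ (value X + value Y)); first exact: addr_ge0.
move=> n n1; rewrite rmorphM /=.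
have x0 := trunc_even_ge0 n X0; have y0 := trunc_even_ge0 n Y0.
have /andP[hx1 hx2] := trunc_even_itv X n; have /andP[hy1 hy2] := trunc_even_itv Y n.
have e0 : 0 <= (2^-1 : R) ^+ n by rewrite exprn_ge0 // invr_ge0.
move: x0 y0 hx1 hx2 hy1 hy2 e0.
set x := ratr _; set y := ratr _; set e := _ ^+ n => x0 y0 hx1 hx2 hy1 hy2 e0.
rewrite ler_pM // andbT.
have h1 : (value X - e) * value Y <= x * value Y by rewrite ler_wpM2r.
have h2 : x * (value Y - e) <= x * y by rewrite ler_wpM2l.
have h3 : x * e <= value X * e by rewrite ler_wpM2r.
lra.
Qed.

Lemma value_Szero : value (Szero c) = 0. Proof. exact: Sint_value. Qed.

Lemma value_Sone : value (Sone c) = 1. Proof. exact: Sint_value. Qed.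

Lemma value_Smul X Y : value (Smul X Y) = value X * value Y.
Proof.
have S0 Z : Sle (Szero c) Z <-> 0 <= value Z by rewrite Sle_value value_Szero.
have S0' Z : Sle Z (Szero c) <-> value Z <= 0 by rewrite Sle_value value_Szero.
rewrite /Smul; case: asboolP => [[/S0 X0 /S0 Y0]|h1].
  exact: value_Smul_nonneg.
case: asboolP => [[/S0' X0 /S0' Y0]|h2].
  by rewrite value_Smul_nonneg ?value_Sopp ?oppr_ge0 // mulrNN.
case: asboolP => [[/S0' X0 /S0 Y0]|h3].
  by rewrite value_Sopp value_Smul_nonneg ?value_Sopp ?oppr_ge0 // mulNr opprK.
(* Only [0 < value X] with [value Y <= 0] reaches the last branch. *)
have [X0|X0] := leP (value X) 0; have [Y0|Y0] := leP (value Y) 0.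
- by case: h2; split; apply/S0'.
- by case: h3; split; [apply/S0'|apply/S0/ltW].
- by rewrite value_Sopp value_Smul_nonneg ?value_Sopp ?oppr_ge0 // ?mulrN ?opprK // ltW.
- by case: h1; split; apply/S0/ltW.
Qed.

Lemma value_Sinv_pos X : 0 < value X -> value (Sinv_pos X) = (value X)^-1.
Proof.
(* The error [(x - value X) / (value X * x)] is at most [(x - value X) / value X ^+ 2], since
   [value X <= x]. *)
move=> X0; apply: (@Ssup_value _ _ ((value X)^-1 ^+ 2)); first by rewrite exprn_ge0 ?invr_ge0 ?ltW.
move=> n n1; rewrite fmorphV /=.
have := trunc_odd_itv X n1; set x := ratr _; set e := _ ^+ n => /andP[h1 h2].
have x0 : 0 < x by apply: lt_le_trans h1.
rewrite lef_pV2 ?posrE // h1 andbT lerBlDl -lerBlDr.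
have -> : (value X)^-1 - x^-1 = (value X)^-1 ^+ 2 * ((x - value X) * (value X / x)).
  by field; rewrite !gt_eqF.
apply: ler_wpM2l; first by rewrite exprn_ge0 // invr_ge0 ltW.
have v1 : value X / x <= 1 by rewrite ler_pdivrMr // mul1r.
apply: le_trans (_ : x - value X <= _); last by lra.
by rewrite ler_piMr // subr_ge0.
Qed.

Lemma value_Sinv X : value (Sinv X) = (value X)^-1.
Proof.
rewrite /Sinv; case: asboolP => [/Slt_value|/Slt_value h1].
  by rewrite value_Szero; exact: value_Sinv_pos.
case: asboolP => [/Slt_value|/Slt_value h2].
  rewrite value_Szero => X0.
  by rewrite value_Sopp value_Sinv_pos ?value_Sopp ?oppr_gt0 // invrN opprK.
(* At zero the convention of [Sinv] agrees with [0^-1 = 0] in [R]. *)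
move: h1 h2; rewrite value_Szero; case: (ltgtP (value X) 0) => // -> _ _.
by rewrite invr0.
Qed.

(** * The isomorphism, the field axioms and completeness *)

Lemma value_bij : bijective (value : Sseq c -> R).
Proof.
exists expansion => [X|v]; last exact: value_expansion.
by apply: value_inj; rewrite value_expansion.
Qed.

Lemma Sseq_ordered_field : ordered_field (Szero c) (Sone c) (@Sadd c) (@Smul c)
  (@Sopp c) (@Sinv c) (@Slt c).
Proof.
exact: (ordered_field_transfer value_inj value_Szero value_Sone value_Sadd
  value_Smul value_Sopp value_Sinv Slt_value).
Qed.

Lemma Sseq_complete (A : set (Sseq c)) : A !=set0 ->
  (exists b : Sseq c, Sis_ub A b) -> exists s : Sseq c, Sis_lub A s.
Proof.
move=> [X0 AX0] [b ub_b]; exists (expansion (sup (value @` A))); split=> [X AX|d ub_d].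
  apply/Sle_value; rewrite value_expansion; apply: ub_le_sup; last by exists X.
  by exists (value b) => _ [Y AY <-]; apply/Sle_value/ub_b.
apply/Sle_value; rewrite value_expansion; apply: ge_sup.
  by exists (value X0), X0.
by move=> _ [Y AY <-]; apply/Sle_value/ub_d.
Qed.

End Real.
End Value.

Theorem theorem3p18 (c : nat -> nat)
  (c_gt0 : forall n : nat, (1 <= n)%N -> (0 < c n)%N)
  (c_dvd : forall n : nat, (1 <= n)%N -> (c n %| c n.+1)%N) :
  [/\ ordered_field (Szero c) (Sone c) (@Sadd c) (@Smul c)
        (@Sopp c) (@Sinv c) (@Slt c),
      forall A : set (Sseq c), A !=set0 -> (exists b : Sseq c, Sis_ub A b) ->
        exists s : Sseq c, Sis_lub A s &
      forall R : realType, exists f : Sseq c -> R,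
        bijective f /\
        [/\ f (Szero c) = 0,
            f (Sone c) = 1,
            forall X Y : Sseq c, f (Sadd X Y) = f X + f Y,
            forall X Y : Sseq c, f (Smul X Y) = f X * f Y &
            forall X Y : Sseq c, Slt X Y <-> f X < f Y]].
Proof.
split.
(* The first two claims mention no real field, so a concrete model of the reals is supplied. *)
- exact: (Sseq_ordered_field c_gt0 c_dvd Rdefinitions.R).
- exact: (Sseq_complete c_gt0 c_dvd Rdefinitions.R).
- move=> R; exists (@value c R); split; first exact: value_bij.
  split; [exact: value_Szero|exact: value_Sone|exact: value_Sadd
         |exact: value_Smul|exact: Slt_value].
Qed.
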